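(* Let $q\in\mathcal S\subseteq\mathcal N$, let $T_q\in\mathcal T^{\bullet q}_{\mathcal S}$ and let $\mathsf T$ be the corresponding undirected tree. Then $T_q\in\tilde{\mathcal T}^{\bullet q}_{\mathcal S}$ if and only if $\mathsf T\in\tilde{\mathsf T}_{\mathcal S}$.
   Context: A potential graph is a finite connected undirected graph $\mathsf P$ with vertex set $\mathcal N$ and edge set $\mathcal E\mathsf P$, with a loop at every vertex, whose edges and loops carry real weights $p_{ij}=p_{ji}$ (loops: $p_{ii}$). Its barrier digraph $V$ is the loopless digraph on $\mathcal N$ with an arc $(i,j)$, $i\neq j$, iff $(i,j)\in\mathcal E\mathsf P$, with arc weights $v_{ij}=p_{ij}-p_{ii}$. Fix such $\mathsf P$ and $V$. An entering tree is a digraph whose underlying graph is a tree, with at most one arc leaving each vertex; its root is the unique vertex with no outgoing arc. $\mathcal T^{\bullet q}_{\mathcal S}$ is the set of entering trees that are subgraphs of $V$ with vertex set $\mathcal S$ and root $q$; the weight of such $T$ is $\Upsilon^T=\sum v_{ij}$ over arcs $(i,j)$ of $T$; $\tilde{\mathcal T}^{\bullet q}_{\mathcal S}$ is the set of minimum-weight trees in $\mathcal T^{\bullet q}_{\mathcal S}$. Denote by $\mathsf T_{\mathcal S}$ the set of undirected trees that are subgraphs of $\mathsf P$ with vertex set $\mathcal S$ (trees contain no loops); the weight of such $\mathsf T$ is $\Upsilon^{\mathsf T}=\sum p_{ij}$ over edges of $\mathsf T$; $\tilde{\mathsf T}_{\mathcal S}$ is the set of minimum-weight trees in $\mathsf T_{\mathcal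 S}$. The undirected tree corresponding to an entering tree $T_q$ is obtained by replacing each arc $(r,t)$ of weight $v_{rt}$ by the edge $(r,t)$ of weight $p_{rt}$. *)

(* Defs.v *)
From HB Require Import structures.
From mathcomp Require Import all_boot all_order all_algebra.
From mathcomp Require Import reals.

Set Implicit Arguments.
Unset Strict Implicit.
Unset Printing Implicit Defensive.

Import Order.TTheory GRing.Theory Num.Theory.
Local Open Scope ring_scope.

(* An undirected edge is the set of its end-vertices: {i, j} for a proper     *)
(* edge, {i} for the loop at i. Note that [set i; i] = [set i] (setUid).      *)
Record ugraph (N : finType) := UGraph {
  uverts : {set N};
  uedges : {set {set N}};
  uedges_wf : forall e, e \in uedges -> (e \subset uverts) && (0 < #|e| <= 2)%N
}.

Record digraph (N : finType) := Digraph {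
  dverts : {set N};
  darcs : {set N * N};
  darcs_wf : darcs \subset setX dverts dverts
}.

Section Graphs.
Variable N : finType.
Implicit Types (G H : ugraph N) (D C : digraph N).

Definition uadj G : rel N := fun i j => [set i; j] \in uedges G.

Definition uconnected G : Prop :=
  uverts G != set0 /\ {in uverts G &, forall i j, connect (uadj G) i j}.

(* A uniq uadj-cycle of two vertices runs twice through the same edge, hence  *)
(* is not a cycle of the graph; one of a single vertex is a loop.             *)
Definition uacyclic G : Prop :=
  (forall i, [set i] \notin uedges G) /\
  (forall c : seq N, ucycle (uadj G) c -> (size c <= 2)%N).

Definition utree G : Prop := uconnected G /\ uacyclic G.

Definition usubgraph G H : bool :=
  (uverts G \subset uverts H) && (uedges G \subset uedges H).

Definition dsubgraph D C : bool :=
  (dverts D \subset dverts C) && (darcs D \subset darcs C).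

Definition outdeg D i : nat := #|[set j | (i, j) \in darcs D]|.

Lemma underlying_wf D e :
  e \in [set [set a.1; a.2] | a in darcs D] ->
  (e \subset dverts D) && (0 < #|e| <= 2)%N.
Proof.
case/imsetP=> a aD ->; have := subsetP (darcs_wf D) _ aD.
rewrite inE => /andP[a1 a2]; rewrite subUset !sub1set a1 a2 /=.
by rewrite cards2; case: (_ != _).
Qed.

Definition underlying D : ugraph N := UGraph (@underlying_wf D).

(* Since edges form a set, antiparallel arcs (i, j), (j, i) have the same     *)
(* image in underlying D, although they make a cycle of length 2 in the       *)
(* underlying multigraph; entering trees therefore exclude them explicitly.   *)
Definition entering_tree D : Prop :=
  [/\ utree (underlying D),
      forall i j, (i, j) \in darcs D -> (j, i) \notin darcs D
    & forall i, i \in dverts D -> (outdeg D i <= 1)%N].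

Definition is_root D (q : N) : Prop :=
  [set i in dverts D | outdeg D i == 0%N] = [set q].

End Graphs.

(* The weight p_ij = p_ji of the edge {i, j} is pweight [set i; j], and p_ii  *)
(* is pweight [set i]; values of pweight outside the edge set are irrelevant. *)
Record potential_graph (R : realType) (N : finType) := PotentialGraph {
  pgraph :> ugraph N;
  pweight : {set N} -> R;
  pverts : uverts pgraph = [set: N];
  pconnected : uconnected pgraph;
  ploops : forall i, [set i] \in uedges pgraph
}.

Section Potential.
Variables (R : realType) (N : finType) (P : potential_graph R N).

Definition p (i j : N) : R := pweight P [set i; j].

Definition barrier_arcs : {set N * N} :=
  [set a | (a.1 != a.2) && ([set a.1; a.2] \in uedges P)].

Lemma barrier_wf : barrier_arcs \subset setX (uverts P) (uverts P).
Proof. by apply/subsetP=> a _; rewrite pverts !inE. Qed.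

Definition barrier : digraph N := Digraph barrier_wf.

Definition v (i j : N) : R := p i j - p i i.

Definition dweight (D : digraph N) : R := \sum_(a in darcs D) v a.1 a.2.

Definition uweight (G : ugraph N) : R := \sum_(e in uedges G) pweight P e.

Definition entering_trees (S : {set N}) (q : N) (D : digraph N) : Prop :=
  [/\ entering_tree D, dsubgraph D barrier, dverts D = S & is_root D q].

Definition min_entering_trees (S : {set N}) (q : N) (D : digraph N) : Prop :=
  entering_trees S q D /\
  (forall D', entering_trees S q D' -> dweight D <= dweight D').

Definition utrees (S : {set N}) (G : ugraph N) : Prop :=
  [/\ utree G, usubgraph G P & uverts G = S].

Definition min_utrees (S : {set N}) (G : ugraph N) : Prop :=
  utrees S G /\ (forall G', utrees S G' -> uweight G <= uweight G').

End Potential.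

(* Main.v *)
(** For an entering tree [D] on [S] with root [q], every vertex of [S] except
    [q] has exactly one outgoing arc, so the weights of [D] and of its underlying
    tree differ by the sum of [p_ii] over [S \ {q}], which does not depend
    on [D].  Conversely every undirected tree on [S] is the underlying graph of
    the entering tree obtained by directing its edges towards [q]. *)
Require Import Defs.
From mathcomp Require Import all_boot all_order all_algebra.
From mathcomp Require Import reals.

Set Implicit Arguments.
Unset Strict Implicit.
Unset Printing Implicit Defensive.

Import Order.TTheory GRing.Theory Num.Theory.
Local Open Scope ring_scope.

Lemma set2_inj (T : finType) (a b c d : T) :
  [set a; b] = [set c; d] -> (a = c /\ b = d) \/ (a = d /\ b = c).
Proof.
move=> E; have [ha hb] : a \in [set c; d] /\ b \in [set c; d].
  by rewrite -E set21 set22.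
have [hc hd] : c \in [set a; b] /\ d \in [set a; b] by rewrite E set21 set22.
move: ha hb hc hd; rewrite !inE.
by do 4![case/orP=> /eqP ?]; subst; auto.
Qed.

Section Avoid.
Variables (T : finType) (e : rel T).

(** Adjacency after deleting vertex [i]; banning [i] at both ends keeps it symmetric. The empty path
    still connects [i] to itself, so path extraction needs a start other than [i]. *)
Definition avoid (i : T) : rel T := fun x y => [&& e x y, x != i & y != i].

Lemma avoid_sym i : symmetric e -> symmetric (avoid i).
Proof. by move=> e_sym x y; rewrite /avoid e_sym andbA andbAC -andbA. Qed.

Lemma path_avoid i x s : path e x s -> i \notin x :: s -> path (avoid i) x s.
Proof.
elim: s x => //= y s IHs x /andP[exy pys]; rewrite !inE !negb_or.
case/and3P=> ix iy is'; rewrite /avoid exy eq_sym ix eq_sym iy /=.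
by apply: IHs => //; rewrite inE negb_or iy.
Qed.

Lemma connect_avoidP i x y : x != i -> connect (avoid i) x y ->
  exists s, [/\ path e x s, y = last x s, uniq (x :: s) & i \notin x :: s].
Proof.
move=> xi /connectP[s0 + ->]; case/shortenP=> s ps us _; exists s; split=> //.
  by apply: sub_path ps => u w /andP[].
rewrite inE negb_or eq_sym xi /=.
elim: s x ps {xi us} => //= z s IHs x /andP[/and3P[_ _ zi] /IHs].
by rewrite inE negb_or eq_sym zi.
Qed.

End Avoid.

Section Orientation.
Variables (N : finType) (G : ugraph N) (q : N).
Hypotheses (Gtree : utree G) (qG : q \in uverts G).

Lemma uadj_sym : symmetric (uadj G).
Proof. by move=> x y; rewrite /uadj setUC. Qed.

Lemma uadj_neq i j : uadj G i j -> i != j.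
Proof.
by apply: contraL => /eqP->; rewrite /uadj setUid; case: Gtree => _ [].
Qed.

Lemma uadj_verts i j : uadj G i j -> (i \in uverts G) && (j \in uverts G).
Proof. by move/uedges_wf => /andP[]; rewrite subUset !sub1set. Qed.

(** An edge is directed from [i] to [j] when [j] still reaches [q] once [i] is deleted, that is,
    when [j] lies on the side of [q]. *)
Definition orient_arcs : {set N * N} :=
  [set a | uadj G a.1 a.2 && connect (avoid (uadj G) a.1) a.2 q].

Lemma orient_wf : orient_arcs \subset setX (uverts G) (uverts G).
Proof. by apply/subsetP=> a; rewrite !inE => /andP[/uadj_verts]. Qed.

Definition orient : digraph N := Digraph orient_wf.

(** Two distinct heads would both reach [q] without [i], so a simple path avoiding [i] would join
    them and close through [i] into a cycle. *)
Lemma orient_functional i j k :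
  (i, j) \in orient_arcs -> (i, k) \in orient_arcs -> j = k.
Proof.
rewrite !inE /= => /andP[ij jq] /andP[ik kq].
apply/eqP/negPn/negP=> jk.
have [||s [ps lst us iNs]] := @connect_avoidP _ (uadj G) i j k.
- by rewrite eq_sym uadj_neq.
- by apply: connect_trans jq _; rewrite (sym_connect_sym (avoid_sym i uadj_sym)).
have [_ [_ acyc]] := Gtree.
have /acyc : ucycle (uadj G) [:: i, j & s].
  rewrite /ucycle cons_uniq iNs us andbT /= ij rcons_path ps -lst uadj_sym.
  by rewrite ik.
(* The cycle has length at most 2, so [s] is empty and its last vertex [k] is [j]. *)
by case: s lst {ps us iNs} => //= lst; rewrite lst eqxx in jk.
Qed.

(** Simplicity keeps the rest of the path away from [i], so it witnesses the arc. *)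
Lemma orient_path i x s : path (uadj G) i (x :: s) -> uniq [:: i, x & s] ->
  last x s = q -> (i, x) \in orient_arcs.
Proof.
move=> /= /andP[ix ps] /andP[iNs _] sq; rewrite inE /= ix.
by apply/connectP; exists s; rewrite ?sq //; apply: path_avoid.
Qed.

Lemma simple_path_to_root i : i \in uverts G ->
  exists s, [/\ path (uadj G) i s, q = last i s & uniq (i :: s)].
Proof.
move=> iG; have [[_ conn] _] := Gtree.
have /connectP[s0 + ->] := conn _ _ iG qG.
by case/shortenP=> s ps us _; exists s.
Qed.

Lemma orient_from_root j : (q, j) \notin orient_arcs.
Proof.
apply/negP; rewrite inE /= => /andP[qj].
case/connect_avoidP; first by rewrite eq_sym uadj_neq.
by move=> s [_ qE _]; rewrite {1}qE mem_last.
Qed.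

(* A simple path from [j] to [q] avoiding [i] starts with the unique arc
   leaving [j], which therefore cannot be [(j, i)]. *)
Lemma orient_antisym i j :
  (i, j) \in orient_arcs -> (j, i) \notin orient_arcs.
Proof.
move=> ij; apply/negP=> ji; move: (ij); rewrite inE /= => /andP[eij].
case/connect_avoidP; first by rewrite eq_sym uadj_neq.
case=> [|x s] [ps qE us iNs].
  by have := orient_from_root i; rewrite qE ji.
have jx := orient_path ps us (esym qE).
by rewrite (orient_functional ji jx) !inE eqxx orbT in iNs.
Qed.

Lemma orient_out i : i \in uverts G -> i != q ->
  exists j, (i, j) \in orient_arcs.
Proof.
move=> /simple_path_to_root[[|x s] [ps qE us]]; first by rewrite qE eqxx.
by move=> _; exists x; apply: orient_path ps us (esym qE).
Qed.

(** Take a simple path from [j] to [q]. If it misses [i], it witnesses [(i, j)]; otherwise its part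
    from [i] onwards misses [j] and witnesses [(j, i)]. *)
Lemma orient_edge i j : uadj G i j ->
  ((i, j) \in orient_arcs) || ((j, i) \in orient_arcs).
Proof.
move=> ij; have /andP[iG jG] := uadj_verts ij.
have [s [ps qE us]] := simple_path_to_root jG.
have [|iNs] := boolP (i \in j :: s); last first.
  rewrite inE /= ij /=; apply/orP; left; apply/connectP.
  by exists s => //; apply: path_avoid.
rewrite inE (negPf (uadj_neq ij)) /= => is'.
case/splitPr: is' ps qE us => s1 s2.
rewrite cat_path last_cat /= => /and3P[_ _ ps2] qE /andP[jN _].
apply/orP; right; rewrite inE /= uadj_sym ij /=; apply/connectP.
exists s2 => //; apply: path_avoid => //.
by move: jN; rewrite mem_cat negb_or => /andP[].
Qed.

Lemma uedges_underlying_orient : uedges (underlying orient) = uedges G.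
Proof.
apply/setP=> f; apply/imsetP/idP => [[a aG ->]|fG].
  by move: aG; rewrite inE => /andP[].
have /andP[_ /andP[f_gt0 f_le2]] := uedges_wf fG.
(* A one-element edge would be a loop, which acyclicity forbids. *)
have /cards2P[i [j [_ fE]]] : #|f| == 2%N.
  rewrite eqn_leq f_le2 ltn_neqAle f_gt0 andbT /= eq_sym.
  apply/negP=> /cards1P[x fx]; have [_ [/(_ x)]] := Gtree.
  by rewrite -fx fG.
have eij : uadj G i j by rewrite /uadj -fE.
have /orP[ij|ji] := orient_edge eij; first by exists (i, j).
by exists (j, i); rewrite // setUC.
Qed.

End Orientation.

(** [utree] reads only the vertex and edge sets, so the well-formedness proofs stored in the two
    records may differ. *)
Lemma utree_ext (N : finType) (G H : ugraph N) :
  uverts G = uverts H -> uedges G = uedges H -> utree G -> utree H.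
Proof.
by case: G => V E wf; case: H => V' E' wf' /= VE EE; subst V' E'.
Qed.

Lemma is_root_outdeg (N : finType) (D : digraph N) (q : N) :
  is_root D q -> {in dverts D, forall i, (outdeg D i == 0%N) = (i == q)}.
Proof. by move=> /setP Dq i iD; have := Dq i; rewrite !inE iD. Qed.

Lemma outdeg_eq0P (N : finType) (D : digraph N) i :
  reflect (forall j, (i, j) \notin darcs D) (outdeg D i == 0%N).
Proof.
rewrite cards_eq0; apply: (iffP eqP) => [/setP Di j|Di].
  by have := Di j; rewrite !inE => ->.
by apply/setP=> j; rewrite !inE (negPf (Di j)).
Qed.

Section Weights.
Variables (R : realType) (N : finType) (P : potential_graph R N).
Variables (S : {set N}) (q : N).

Lemma dweight_underlying (D : digraph N) : entering_trees P S q D ->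
  dweight P D = uweight P (underlying D) - \sum_(i in S :\ q) p P i i.
Proof.
move=> [[_ anti out] _ DS /is_root_outdeg Dq].
have arcs_verts a : a \in darcs D -> a.1 \in dverts D.
  by move/(subsetP (darcs_wf D)); rewrite inE => /andP[].
rewrite /dweight /v sumrB; congr (_ - _).
  (* Without antiparallel arcs, distinct arcs give distinct edges, so the sum over edges reindexes
     over arcs. *)
  rewrite /uweight /= big_imset //=.
  move=> [a b] [c d] abD cdD /= /set2_inj[[-> ->] //|[ac bd]].
  by subst; have := anti _ _ abD; rewrite cdD.
(* The tails of arcs are exactly the non-root vertices; out-degree at most 1 then makes the map from
   arcs to tails injective. *)
have -> : S :\ q = [set a.1 | a in darcs D].
  apply/setP=> i; apply/idP/imsetP => [|[[j k] jkD /= ->]]; rewrite !inE -DS.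
    case/andP=> iq iD; have: outdeg D i != 0%N by rewrite Dq.
    by rewrite cards_eq0 => /set0Pn[j]; rewrite inE => ijD; exists (i, j).
  have jD := arcs_verts _ jkD; rewrite jD -Dq // andbT.
  by apply/negP=> /outdeg_eq0P/(_ k)/negP.
rewrite big_imset //= => -[i j] [k l] ijD klD /= ik; subst k; congr (_, _).
have /card_le1_eqP := out _ (arcs_verts _ ijD).
by apply; rewrite inE.
Qed.

Lemma utrees_underlying (D : digraph N) :
  entering_trees P S q D -> utrees P S (underlying D).
Proof.
move=> [[Dtree _ _] /andP[_ /subsetP sDP] DS _]; split=> //.
rewrite /usubgraph pverts subsetT; apply/subsetP=> f /imsetP[a /sDP + ->].
by rewrite inE => /andP[].
Qed.

Lemma entering_trees_orient (G : ugraph N) :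
  q \in S -> utrees P S G -> entering_trees P S q (orient G q).
Proof.
move=> qS [Gtree /andP[_ /subsetP sGP] GS]; have qG : q \in uverts G by rewrite GS.
split=> //.
- split; [|exact: orient_antisym|].
    by apply: utree_ext (Gtree); rewrite ?uedges_underlying_orient.
  move=> i _; apply/card_le1_eqP=> j k; rewrite in_set => ij; rewrite in_set => ik.
  exact: (orient_functional Gtree ik ij).
- apply/andP; split; first by rewrite /= pverts subsetT.
  apply/subsetP=> a; rewrite !inE => /andP[aG _].
  by rewrite (uadj_neq Gtree aG) sGP.
- apply/setP=> i; rewrite !inE; apply/andP/eqP => [[iG /outdeg_eq0P i0]|->].
    apply/eqP/negPn/negP=> iq; have [j ij] := orient_out Gtree qG iG iq.
    by have := i0 j; rewrite ij.
  by split=> //; apply/outdeg_eq0P => j; apply: orient_from_root.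
Qed.

End Weights.

Theorem theorem3 (R : realType) (N : finType) (P : potential_graph R N)
    (S : {set N}) (q : N) (Tq : digraph N) :
  q \in S ->
  entering_trees P S q Tq ->
  (min_entering_trees P S q Tq <-> min_utrees P S (underlying Tq)).
Proof.
move=> qS TqE; split=> -[_ minT].
  split=> [|G GT]; first exact: utrees_underlying TqE.
  (* The competitor [G] is tested through its orientation towards [q], which has the same edges; the
     common loop sum cancels. *)
  have DE := entering_trees_orient qS GT; have [Gtree _ GS] := GT.
  have := minT _ DE; rewrite !(@dweight_underlying _ _ P S q) // lerD2r.
  by rewrite {2}/uweight uedges_underlying_orient // GS.
split=> // D DE; rewrite !(@dweight_underlying _ _ P S q) // lerD2r.
exact: minT (utrees_underlying DE).
Qed.
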